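(* Let $G$ be a graph of order $n$ containing at least one edge. If $G$ is $(K_2\cup 2K_1)$-free or $G$ has an independent set of size $n-2$, then the dependence polynomial $D(G,x)=\sum_{k=0}^n d_k(G)x^k$ is ultra log-concave, i.e. $$d_k(G)^2\geqslant\left(1+\frac1k\right)\left(1+\frac1{n-k}\right)d_{k-1}(G)\,d_{k+1}(G)\quad\text{for all }1\leqslant k\leqslant n-1.$$
   Context: Graphs are finite, simple, undirected. A dependent set of $G$ is a set $S\subseteq V(G)$ whose induced subgraph $G[S]$ contains at least one edge; $d_k(G)$ is the number of dependent sets of size $k$, and $D(G,x):=\sum_{k\geqslant0}d_k(G)x^k$. $K_2\cup 2K_1$ is the disjoint union of one edge and two isolated vertices; $G$ is $H$-free if no induced subgraph of $G$ is isomorphic to $H$. An independent set is a set of vertices inducing no edges. *)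

(* Defs.v *)
From mathcomp Require Import all_boot all_order all_algebra.
Set Implicit Arguments.
Unset Strict Implicit.
Unset Printing Implicit Defensive.
Import Order.TTheory GRing.Theory Num.Theory.
Local Open Scope ring_scope.

Record sgraph := SGraph {
  vertex :> finType;
  adj : rel vertex;
  adj_sym : symmetric adj;
  adj_irr : irreflexive adj }.

Definition has_edge (G : sgraph) : Prop := exists x y : G, adj x y.

Definition isomorphic (G H : sgraph) : Prop :=
  exists2 f : G -> H, bijective f & forall x y, adj (f x) (f y) = adj x y.

Section Induced.
Variables (G : sgraph) (S : {set G}).

Definition induced_adj : rel {x : G | x \in S} :=
  fun x y => adj (val x) (val y).

Lemma induced_adj_sym : symmetric induced_adj.
Proof. by move=> x y; apply: adj_sym. Qed.

Lemma induced_adj_irr : irreflexive induced_adj.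
Proof. by move=> x; apply: adj_irr. Qed.

Definition induced : sgraph := SGraph induced_adj_sym induced_adj_irr.
End Induced.

Definition free_of (H G : sgraph) : Prop :=
  forall S : {set G}, ~ isomorphic (induced S) H.

Section Complete.
Variable n : nat.

Definition complete_adj : rel 'I_n := fun x y => x != y.

Lemma complete_adj_sym : symmetric complete_adj.
Proof. by move=> x y; rewrite /complete_adj eq_sym. Qed.

Lemma complete_adj_irr : irreflexive complete_adj.
Proof. by move=> x; rewrite /complete_adj eqxx. Qed.

Definition complete : sgraph := SGraph complete_adj_sym complete_adj_irr.
End Complete.

Section DisjointUnion.
Variables G H : sgraph.

Definition union_adj : rel (G + H) := fun u v =>
  match u, v with
  | inl x, inl y => adj x y
  | inr x, inr y => adj x y
  | _, _ => false
  end.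

Lemma union_adj_sym : symmetric union_adj.
Proof. by move=> [x|x] [y|y] //=; apply: adj_sym. Qed.

Lemma union_adj_irr : irreflexive union_adj.
Proof. by move=> [x|x] /=; apply: adj_irr. Qed.

Definition disjoint_union : sgraph := SGraph union_adj_sym union_adj_irr.
End DisjointUnion.

Definition K2_2K1 : sgraph :=
  disjoint_union (complete 2) (disjoint_union (complete 1) (complete 1)).

Section Dependence.
Variable G : sgraph.

(* Boolean form of [has_edge (induced S)], so that such sets can be counted;
   see [dependentP]. *)
Definition dependent (S : {set G}) : bool :=
  [exists x in S, exists y in S, adj x y].

Lemma dependentP (S : {set G}) : reflect (has_edge (induced S)) (dependent S).
Proof.
apply: (iffP existsP) => [[x /andP[xS /existsP[y /andP[yS xy]]]]|].
  by exists (exist _ x xS), (exist _ y yS).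
case=> [[x xS] [[y yS] xy]]; exists x; rewrite xS /=.
by apply/existsP; exists y; rewrite yS.
Qed.

Definition independent (S : {set G}) : Prop := ~ has_edge (induced S).

Definition dep_num (k : nat) : nat :=
  #|[set S : {set G} | dependent S & #|S| == k]|.

Definition dep_poly : {poly rat} :=
  \poly_(k < #|G|.+1) (dep_num k)%:R.
End Dependence.

(* [n] is the nominal degree of [p]. *)
Definition ultra_log_concave (n : nat) (p : {poly rat}) : Prop :=
  forall k : nat, (0 < k < n)%N ->
    p`_k ^+ 2 >=
      (1 + k%:R^-1) * (1 + (n - k)%N%:R^-1) * p`_k.-1 * p`_k.+1.

(* Main.v *)
Require Import Defs.
From mathcomp Require Import all_boot all_order all_algebra.
From mathcomp Require Import ring lra zify.

(* Ultra log-concavity says that the probability y_k = d_k / 'C(n, k) that a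
   uniform k-set is dependent is log-concave; this is trivial for k <= 2 because
   d_1 = 0, and for k >= 3 a suitable normalization is even concave.

   If G is (K2 u 2K1)-free, y itself is concave. Indeed
   (k+1) d_(k+1) = (n-k) d_k + e_k, where e_k counts the pairs (I, v) with I an
   independent k-set and I + v dependent, so the increments of y are normalized
   e_k's. For |I| >= 3 such a v misses at most one vertex of I, so deleting any
   u from I leaves a pair of the same kind, whence k e_k <= (n-k) e_(k-1).

   If M is independent and V \ M = {a, b}, then x_k = d_k / 'C(n-1, k-1) is
   concave, and y_k = (k/n) x_k is a product of log-concave sequences. Splitting
   independent sets by their trace on {a, b} writes x as a combination of the
   sequences j |-> 'C(N-r, j) / 'C(N, j), N = n-1, whose second differences are
   r (r-1) times positive quantities decreasing in r. *)

Set Implicit Arguments.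
Unset Strict Implicit.
Unset Printing Implicit Defensive.
Import Order.TTheory GRing.Theory Num.Theory.
Local Open Scope ring_scope.

(** * Log-concavity from concavity, and binomial normalization *)

(** AM-GM: [4 a c <= (a + c)^2 <= 4 b^2]. *)
Lemma mul_le_sqr_of_concave (a b c : rat) :
  0 <= a -> 0 <= c -> a + c <= b *+ 2 -> a * c <= b ^+ 2.
Proof.
move=> a0 c0 h.
have h1 : (a + c) ^+ 2 <= (b *+ 2) ^+ 2.
  by apply: lerXn2r; rewrite ?nnegrE // ?(le_trans _ h) ?addr_ge0.
have h2 : 0 <= (a - c) ^+ 2 by apply: sqr_ge0.
lra.
Qed.

(** Subtraction is taken in [rat], so [n - k] may be negative; for [k > n] both binomials vanish. *)
Lemma bin_step (n k : nat) :
  k.+1%:R * 'C(n, k.+1)%:R = (n%:R - k%:R) * 'C(n, k)%:R :> rat.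
Proof.
case: (leqP k n) => [kn|nk]; first by rewrite -natrB // -!natrM mul_bin_left.
by rewrite !bin_small ?mulr0 // ltnW.
Qed.

(* The constants [1 + 1/k] and [1 + 1/(n-k)] are exactly those turning
   log-concavity of [p`_k / 'C(n, k)] into that of [p`_k]. *)
Lemma ulc_of_normalized (n : nat) (p : {poly rat}) :
    (forall k, (0 < k < n)%N ->
      (p`_k.-1 / 'C(n, k.-1)%:R) * (p`_k.+1 / 'C(n, k.+1)%:R)
        <= (p`_k / 'C(n, k)%:R) ^+ 2) ->
  ultra_log_concave n p.
Proof.
move=> H [//|k] kn; move/(_ _ kn): H => /=; case/andP: kn => _ kn.
have b0 : 0 < 'C(n, k)%:R :> rat by rewrite ltr0n bin_gt0; lia.
have b1 : 0 < 'C(n, k.+1)%:R :> rat by rewrite ltr0n bin_gt0; lia.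
have b2 : 0 < 'C(n, k.+2)%:R :> rat by rewrite ltr0n bin_gt0; lia.
have e0 := bin_step n k; have e1 := bin_step n k.+1.
have k1 : 0 < k.+1%:R :> rat by rewrite ltr0n.
have k2 : k.+2%:R = k.+1%:R + 1 :> rat by rewrite -natr1.
have nk : 0 < n%:R - k.+1%:R :> rat by rewrite subr_gt0 ltr_nat.
have nk0 : n%:R - k%:R = (n%:R - k.+1%:R) + 1 :> rat by rewrite -natr1; ring.
rewrite natrB //; last by lia.
move: e0 e1; rewrite nk0 k2; move: nk k1 b0 b1 b2 {nk0 k2}.
set u := (n%:R - k.+1%:R); set v := k.+1%:R.
set c0 := 'C(n, k)%:R; set c1 := 'C(n, k.+1)%:R; set c2 := 'C(n, k.+2)%:R.
move: u v c0 c1 c2 => u v c0 c1 c2 u0 v0 c00 c10 c20 e0 e1 H.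
have uN := lt0r_neq0 u0; have vN := lt0r_neq0 v0.
have c0N := lt0r_neq0 c00; have c1N := lt0r_neq0 c10; have c2N := lt0r_neq0 c20.
have u1N : u + 1 != 0 by rewrite lt0r_neq0 // addr_gt0.
have v1N : v + 1 != 0 by rewrite lt0r_neq0 // addr_gt0.
(* Here [v] is the middle index and [u] its complement to [n]; these two formulas give
   [c1^2 / (c0 c2) = (1 + 1/v) (1 + 1/u)]. *)
have E0 : c0 = v * c1 / (u + 1) by rewrite e0; field.
have E2 : c2 = u * c1 / (v + 1) by rewrite -e1; field.
have -> : p`_k.+1 ^+ 2 = (p`_k.+1 / c1) ^+ 2 * c1 ^+ 2 by field.
have -> : (1 + v^-1) * (1 + u^-1) * p`_k * p`_k.+2
          = (p`_k / c0 * (p`_k.+2 / c2)) * c1 ^+ 2.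
  by rewrite E0 E2; field; rewrite ?uN ?vN ?c1N ?u1N ?v1N.
by rewrite ler_wpM2r // exprn_ge0 // ltW.
Qed.

(** * Double counting of sets with a marked element *)

Section DoubleCounting.
Variable T : finType.

(** The bijection [(S, v) -> (S :\ v, v)], with inverse [(S, v) -> (v |: S, v)], matches the
    terms. *)
Lemma sum_remove_add (F : {set T} -> T -> nat) (k : nat) :
  (\sum_(S : {set T} | #|S| == k.+1) \sum_(v in S) F (S :\ v) v
   = \sum_(S : {set T} | #|S| == k) \sum_(v | v \notin S) F S v)%N.
Proof.
rewrite !pair_big_dep /=.
rewrite (reindex_onto (fun p : {set T} * T => (p.2 |: p.1, p.2))
                      (fun p : {set T} * T => (p.1 :\ p.2, p.2))) /=; last first.
  by case=> S v /= /andP[_ vS]; rewrite setD1K.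
apply: eq_big => [[S v]|[S v]] /=.
  rewrite xpair_eqE eqxx andbT setU11 andbT cardsU1.
  case: (boolP (v \in S)) => vS /=; last by rewrite setU1K // eqxx andbT.
  rewrite andbF; apply/negP => /andP[_ /eqP SE].
  by move: vS; rewrite -SE !inE eqxx.
by rewrite xpair_eqE => /andP[_ /andP[/eqP-> _]].
Qed.

Lemma card_interval (P Q : {set T}) (k : nat) : [disjoint P & Q] ->
  #|[set S : {set T} | [&& P \subset S, S \subset P :|: Q & #|S| == (k + #|P|)%N]]|
  = 'C(#|Q|, k).
Proof.
move=> dPQ; rewrite -cards_draws -[RHS](@card_in_imset _ _ (fun J => P :|: J)).
  apply: eq_card => S; rewrite inE; apply/and3P/imsetP.
    case=> PS SPQ /eqP cS; exists (S :\: P); last first.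
      by rewrite setDE setUIr setUCr setIT; apply/esym/setUidPr.
    rewrite inE subDset SPQ /= -(eqn_add2r #|P|) -cS.
    by rewrite -(cardsID P S) (setIidPr PS) addnC.
  case=> J; rewrite inE => /andP[JQ /eqP cJ] ->.
  rewrite subsetUl setUS //; split => //.
  rewrite cardsU cJ addnC; have -> : P :&: J = set0.
    by apply/eqP; rewrite setI_eq0; apply: disjointWr dPQ.
  by rewrite cards0 subn0.
have K (J : {set T}) : J \subset Q -> (P :|: J) :\: P = J.
  move=> JQ; rewrite setDUl setDv set0U; apply/setDidPl.
  by rewrite disjoint_sym; apply: disjointWr dPQ.
by move=> J1 J2; rewrite !inE => /andP[/K J1Q _] /andP[/K J2Q _] E; rewrite -J1Q E.
Qed.

End DoubleCounting.

(** * Counting dependent sets by adding one vertex at a time *)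

Section Dependent.
Variable G : sgraph.
Implicit Types S T : {set G}.

Lemma dependent_exP S :
  reflect (exists x y : G, [/\ x \in S, y \in S & adj x y]) (dependent S).
Proof.
apply: (iffP exists_inP) => [[x xS /exists_inP[y yS xy]]|[x [y [xS yS xy]]]].
  by exists x, y.
by exists x => //; apply/exists_inP; exists y.
Qed.

Lemma dependentS S T : S \subset T -> dependent S -> dependent T.
Proof.
move=> /subsetP ST /dependent_exP[x [y [xS yS xy]]].
by apply/dependent_exP; exists x, y; split; rewrite ?ST.
Qed.

Lemma dep_numE k : dep_num G k = (\sum_(S : {set G} | #|S| == k) dependent S)%N.
Proof.
rewrite /dep_num -sum1dep_card [LHS]big_mkcond [RHS]big_mkcond /=.
by apply: eq_bigr => S _; case: (dependent S) => /=; case: (_ == _).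
Qed.

Lemma dep_num_small k : (k < 2)%N -> dep_num G k = 0%N.
Proof.
move=> k2; rewrite dep_numE big1 // => S /eqP cS.
case: dependent_exP => // -[x [y [xS yS xy]]].
suff : (1 < #|S|)%N by lia.
by apply/card_gt1P; exists x, y; split => //; apply: contraTneq xy => ->; rewrite adj_irr.
Qed.

Definition creates_edge (I : {set G}) (v : G) : bool :=
  ~~ dependent I && dependent (v |: I).

(** The quantity [e_k] that drives the increments of the normalized counts. *)
Definition creating_num (k : nat) : nat :=
  (\sum_(I : {set G} | #|I| == k) \sum_(v | v \notin I) creates_edge I v)%N.

Lemma card_notin S : (\sum_(v | v \notin S) 1)%N = (#|G| - #|S|)%N.
Proof. by rewrite sum1_card -(cardC (mem S)) addKn; apply: eq_card. Qed.

(** Mark a vertex [v] in a dependent [(k+1)]-set and delete it: either a dependent [k]-set remains,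
    with [n - k] choices for [v], or an independent one in which [v] creates an edge. *)
Lemma dep_num_rec k :
  (k.+1 * dep_num G k.+1 = (#|G| - k) * dep_num G k + creating_num k)%N.
Proof.
have := sum_remove_add (fun T v => nat_of_bool (dependent (v |: T))) k.
rewrite !dep_numE !big_distrr /= => E.
transitivity (\sum_(S : {set G} | #|S| == k.+1)
                \sum_(v in S) dependent (v |: S :\ v))%N.
  apply: eq_bigr => S /eqP cS.
  rewrite -cS -sum1_card big_distrl /=; apply: eq_bigr => v vS.
  by rewrite setD1K // mul1n.
rewrite E /creating_num -big_split /=; apply: eq_bigr => S /eqP cS.
rewrite -{1}cS -card_notin big_distrl -big_split /=; apply: eq_bigr => v _.
rewrite mul1n /creates_edge; case: (boolP (dependent S)) => //= dS.
by rewrite (dependentS _ dS) // subsetU1.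
Qed.

(** Triples [(J, u, v)] in which [v] creates an edge with [u |: J] are counted [k+1] times per pair
    [(u |: J, v)]; by assumption each lies over a pair [(J, v)] counted by [e_k]. *)
Lemma creating_num_le k :
    (forall (J : {set G}) u v, #|J| = k -> u \notin J -> v \notin u |: J ->
       creates_edge (u |: J) v -> creates_edge J v) ->
  (k.+1 * creating_num k.+1 <= (#|G| - k.+1) * creating_num k)%N.
Proof.
move=> H.
have := sum_remove_add
  (fun T u => \sum_(v | v \notin u |: T) creates_edge (u |: T) v)%N k.
move=> E; rewrite /creating_num !big_distrr /=.
have -> : (\sum_(I : {set G} | #|I| == k.+1)
             k.+1 * \sum_(v | v \notin I) creates_edge I v
    = \sum_(S : {set G} | #|S| == k.+1) \sum_(u in S)
        \sum_(v | v \notin u |: S :\ u) creates_edge (u |: S :\ u) v)%N.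
  apply: eq_bigr => S /eqP cS.
  rewrite -cS -sum1_card big_distrl /=; apply: eq_bigr => v vS.
  by rewrite setD1K // mul1n.
rewrite E; apply: leq_sum => J /eqP cJ.
apply: (@leq_trans (\sum_(u | u \notin J)
   \sum_(v | v \notin u |: J) creates_edge J v)%N).
  apply: leq_sum => u uJ; apply: leq_sum => v vuJ.
  by case: (boolP (creates_edge (u |: J) v)) => // /(H _ _ _ cJ uJ vuJ) ->.
(* For fixed [v], the vertex [u] ranges over the complement of [v |: J], which has [n - (k+1)]
   elements. *)
rewrite (exchange_big_dep (fun v => v \notin J)) /=; last first.
  by move=> u v _; rewrite in_setU1 negb_or => /andP[].
rewrite big_distrr; apply: leq_sum => v vJ.
rewrite (eq_bigl (fun u => u \notin v |: J)); last first.
  by move=> u; rewrite !in_setU1 !negb_or vJ andbT andbC eq_sym.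
by rewrite -{1}[nat_of_bool _]mul1n -big_distrl /= card_notin cardsU1 vJ cJ.
Qed.

Lemma dep_polyE k : (k <= #|G|)%N -> (dep_poly G)`_k = (dep_num G k)%:R.
Proof. by move=> kn; rewrite coef_poly ltnS kn. Qed.

End Dependent.

(** * Graphs without an induced [K2 u 2K1] *)

(** If [v] had no neighbour in [J], then the edge [vu] and any two vertices of the independent set
    [J] would induce [K2 u 2K1]. *)
Lemma creates_edge_remove (G : sgraph) (hG : free_of K2_2K1 G) (J : {set G}) (u v : G) :
    (1 < #|J|)%N -> u \notin J -> v \notin u |: J ->
  creates_edge (u |: J) v -> creates_edge J v.
Proof.
move=> J2 uJ; rewrite in_setU1 negb_or => /andP[vu vJ] /andP[indI depI].
have noadj x y : x \in u |: J -> y \in u |: J -> adj x y = false.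
  move=> xI yI; apply: contraNF indI => xy.
  by apply/dependent_exP; exists x, y.
have indJ : ~~ dependent J by apply: contra indI; apply: dependentS; apply: subsetU1.
rewrite /creates_edge indJ andTb; apply: contraT => indvJ.
have vnoadj x : x \in J -> adj v x = false.
  move=> xJ; apply: contraNF indvJ => vx; apply/dependent_exP.
  by exists v, x; rewrite !in_setU1 eqxx xJ orbT.
(* The edge that appears in [v |: (u |: J)] can only join [v] to [u]. *)
have vadju : adj v u.
  case/dependent_exP: depI => x [y []].
  rewrite in_setU1 => /orP[/eqP->|xI]; rewrite in_setU1 => /orP[/eqP->|yI].
  - by rewrite adj_irr.
  - by move: yI; rewrite in_setU1 => /orP[/eqP->//|/vnoadj->].
  - by rewrite adj_sym; move: xI; rewrite in_setU1 => /orP[/eqP->//|/vnoadj->].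
  - by rewrite noadj.
case/card_gt1P: J2 => w1 [w2 [w1J w2J w12]].
have [uw1 uw2] : u != w1 /\ u != w2 by split; apply: contraNneq uJ => ->.
have [vw1 vw2] : v != w1 /\ v != w2 by split; apply: contraNneq vJ => ->.
pose S := [set v; u; w1; w2].
pose f (x : induced S) : K2_2K1 :=
  if val x == v then inl ord0 else if val x == u then inl ord_max
  else if val x == w1 then inr (inl ord0) else inr (inr ord0).
(* All equalities and, in [ad], all adjacencies among [v], [u], [w1], [w2]: they settle the sixteen
   pairs of vertices of [S]. *)
have ne := (eqxx, negPf vu, negPf uw1, negPf uw2, negPf vw1, negPf vw2, negPf w12,
  eq_sym u v, eq_sym w1 v, eq_sym w2 v, eq_sym w1 u, eq_sym w2 u, eq_sym w2 w1).
have wI w : w \in J -> w \in u |: J by move=> wJ; rewrite in_setU1 wJ orbT.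
have uI : u \in u |: J by rewrite setU11.
have ad := (adj_irr, vadju, adj_sym u v, adj_sym w1 v, adj_sym w2 v,
  vnoadj _ w1J, vnoadj _ w2J, noadj _ _ uI (wI _ w1J), noadj _ _ uI (wI _ w2J),
  noadj _ _ (wI _ w1J) uI, noadj _ _ (wI _ w2J) uI,
  noadj _ _ (wI _ w1J) (wI _ w2J), noadj _ _ (wI _ w2J) (wI _ w1J)).
case: (hG S); exists f; last first.
  move=> [x xS] [y yS]; rewrite /f /= /induced_adj /=.
  move: xS yS; rewrite !inE -!orbA.
  move=> /or4P[] /eqP-> /or4P[] /eqP->; by rewrite !ne /= !ad.
apply: inj_card_bij.
  move=> [x xS] [y yS]; rewrite /f /= => E; apply: val_inj => /=; move: xS yS E.
  rewrite !inE -!orbA.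
  by move=> /or4P[] /eqP-> /or4P[] /eqP->; rewrite !ne.
rewrite !card_sum !card_ord card_sig (eq_card (B := mem S)) //.
by rewrite /S -!setUA !cardsU1 cards1 !inE !ne.
Qed.

(** For [v = k + 1], [u = n - k - 1] and [ci], [di], [ei] the binomials, dependent sets and creating
    pairs at level [k + i], the gap between the two sides is [(u e0 - v e1) / (u v c1)]. *)
Lemma normalized_concave (u v c0 c1 c2 d0 d1 d2 e0 e1 : rat) :
    0 < u -> 0 < v -> 0 < c0 -> 0 < c1 -> 0 < c2 ->
    v * c1 = (u + 1) * c0 -> (v + 1) * c2 = u * c1 ->
    v * d1 = (u + 1) * d0 + e0 -> (v + 1) * d2 = u * d1 + e1 ->
    v * e1 <= u * e0 ->
  d0 / c0 + d2 / c2 <= (d1 / c1) *+ 2.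
Proof.
move=> u0 v0 c00 c10 c20 hc0 hc2 hd0 hd2 he.
have uN := lt0r_neq0 u0; have vN := lt0r_neq0 v0; have c1N := lt0r_neq0 c10.
have u1N : u + 1 != 0 by rewrite lt0r_neq0 // addr_gt0.
have v1N : v + 1 != 0 by rewrite lt0r_neq0 // addr_gt0.
have -> : c0 = v * c1 / (u + 1) by rewrite hc0; field.
have -> : c2 = u * c1 / (v + 1) by rewrite -hc2; field.
have -> : d0 = (v * d1 - e0) / (u + 1) by rewrite hd0; field.
have -> : d2 = (u * d1 + e1) / (v + 1) by rewrite -hd2; field.
rewrite -subr_ge0.
have -> : d1 / c1 *+ 2 - ((v * d1 - e0) / (u + 1) / (v * c1 / (u + 1)) +
    (u * d1 + e1) / (v + 1) / (u * c1 / (v + 1)))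
  = (u * e0 - v * e1) / (u * v * c1).
  by field; rewrite ?uN ?vN ?c1N ?u1N ?v1N.
by rewrite divr_ge0 ?subr_ge0 // ltW // !mulr_gt0.
Qed.

Lemma ulc_of_free (G : sgraph) :
  free_of K2_2K1 G -> ultra_log_concave #|G| (dep_poly G).
Proof.
move=> hG; apply: ulc_of_normalized => -[//|k] /= kn.
have kn1 := ltnW kn; have kn0 := ltnW kn1.
rewrite !dep_polyE //.
(* The middle index is [k + 1]. For [k < 2] the factor [d_k] is zero; otherwise the [k]-sets [J]
   below contain the two vertices that the forbidden subgraph calls for. *)
case: (ltnP k 2) => k2.
  by rewrite (dep_num_small _ k2) !mul0r exprn_ge0 // divr_ge0 // ler0n.
apply: mul_le_sqr_of_concave; rewrite ?divr_ge0 ?ler0n //.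
have rec j (jn : (j <= #|G|)%N) : j.+1%:R * (dep_num G j.+1)%:R
    = (#|G|%:R - j%:R) * (dep_num G j)%:R + (creating_num G j)%:R :> rat.
  by rewrite -natrB // -!natrM -natrD -dep_num_rec.
have nk0 : #|G|%:R - k%:R = (#|G|%:R - k.+1%:R) + 1 :> rat by rewrite -natr1; ring.
apply: (@normalized_concave (#|G|%:R - k.+1%:R) k.+1%:R _ _ _ _ _ _
          (creating_num G k)%:R (creating_num G k.+1)%:R).
- by rewrite subr_gt0 ltr_nat.
- by rewrite ltr0n.
- by rewrite ltr0n bin_gt0; lia.
- by rewrite ltr0n bin_gt0; lia.
- by rewrite ltr0n bin_gt0; lia.
- by rewrite -nk0 bin_step.
- by rewrite natr1 bin_step.
- by rewrite -nk0 rec.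
- by rewrite natr1 rec.
rewrite -natrB // -!natrM ler_nat; apply: creating_num_le => J u v cJ.
by apply: creates_edge_remove; rewrite // cJ.
Qed.

(** * Second differences of binomial ratios *)

(* Probability that a uniform [j]-subset of an [N]-set lies in a fixed [M]-subset. *)
Definition bin_ratio (N M j : nat) : rat := 'C(M, j)%:R / 'C(N, j)%:R.

Lemma bin_ratio_step (N M j : nat) : (j < N)%N ->
  bin_ratio N M j.+1 * (N%:R - j%:R) = bin_ratio N M j * (M%:R - j%:R).
Proof.
move=> jN; rewrite /bin_ratio.
have b0 : 'C(N, j)%:R != 0 :> rat by rewrite pnatr_eq0 -lt0n bin_gt0 ltnW.
have b1 : 'C(N, j.+1)%:R != 0 :> rat by rewrite pnatr_eq0 -lt0n bin_gt0.
have j0 : j.+1%:R != 0 :> rat by rewrite pnatr_eq0.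
have hN := bin_step N j; have hM := bin_step M j.
have Nj : N%:R - j%:R != 0 :> rat by rewrite lt0r_neq0 // subr_gt0 ltr_nat.
have -> : 'C(N, j.+1)%:R = (N%:R - j%:R) * 'C(N, j)%:R / j.+1%:R :> rat.
  by rewrite -hN mulrC mulKf.
have -> : 'C(M, j.+1)%:R = (M%:R - j%:R) * 'C(M, j)%:R / j.+1%:R :> rat.
  by rewrite -hM mulrC mulKf.
by field; rewrite nat1r j0 Nj b0.
Qed.

(** Two applications of the one-step ratio [(M - j) / (N - j)]. The denominator does not involve
    [M], so combinations over several [M] are compared by numerators alone. *)
Lemma bin_ratio_diff2 (N M j : nat) : (j.+1 < N)%N ->
  bin_ratio N M j - bin_ratio N M j.+1 *+ 2 + bin_ratio N M j.+2
  = (N%:R - M%:R) * (N%:R - M%:R - 1) * bin_ratio N M j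
    / ((N%:R - j%:R) * (N%:R - j%:R - 1)).
Proof.
move=> jN; have s0 := bin_ratio_step M (ltnW jN); have s1 := bin_ratio_step M jN.
have Nj : N%:R - j%:R != 0 :> rat by rewrite lt0r_neq0 // subr_gt0 ltr_nat ltnW.
have Nj1 : N%:R - j%:R - 1 != 0 :> rat.
  by rewrite -addrA -opprD natr1 lt0r_neq0 // subr_gt0 ltr_nat.
have E2 : bin_ratio N M j.+2
    = bin_ratio N M j.+1 * (M%:R - j%:R - 1) / (N%:R - j%:R - 1).
  apply: (mulIf Nj1); rewrite divfK //.
  by move: s1; rewrite -natr1 !opprD !addrA.
rewrite E2.
have -> : bin_ratio N M j.+1 = bin_ratio N M j * (M%:R - j%:R) / (N%:R - j%:R).
  by rewrite -s0 mulfK.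
by field; rewrite ?Nj ?Nj1.
Qed.

Lemma bin_ratio_ge0 (N M j : nat) : 0 <= bin_ratio N M j.
Proof. by rewrite divr_ge0 ?ler0n. Qed.

Lemma bin_ratio_le (N M M' j : nat) : (M <= M')%N ->
  bin_ratio N M j <= bin_ratio N M' j.
Proof.
by move=> MM; rewrite ler_wpM2r ?invr_ge0 ?ler0n // ler_nat leq_bin2l.
Qed.

(** Integrality matters: the product is negative strictly between 0 and 1. *)
Lemma natr_mul_pred_ge0 (a : nat) : 0 <= a%:R * (a%:R - 1) :> rat.
Proof. by case: a => [|a]; rewrite ?mul0r // -natr1 addrK mulr_ge0 ?addr_ge0 ?ler0n. Qed.

(* The value of [d_(i+1) / 'C(m+1, i)] when [m] vertices are independent, [A],
   [B], [w] of them avoid the neighbourhoods of the first, the second and both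
   remaining vertices, and [e] tells that these two are not adjacent. *)
Definition two_apex_ratio (m A B w : nat) (e : bool) (i : nat) : rat :=
  bin_ratio m.+1 m i + bin_ratio m.+1 m.+1 i
  - bin_ratio m.+1 A i - bin_ratio m.+1 B i
  - e%:R * (bin_ratio m.+1 w.+1 i - bin_ratio m.+1 w i).

(** Only the term with [e] can spoil concavity, by at most [2 g pw] with [g = m - w]; the terms of
    [A] and [B] make up for it because [g <= (m - A) + (m - B)]. *)
Lemma two_apex_concave (m A B w j : nat) (e : bool) :
    (A <= m)%N -> (B <= m)%N -> (w <= A)%N -> (w <= B)%N -> (A + B <= m + w)%N ->
    (j.+1 < m.+1)%N ->
  two_apex_ratio m A B w e j + two_apex_ratio m A B w e j.+2
  <= two_apex_ratio m A B w e j.+1 *+ 2.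
Proof.
move=> Am Bm wA wB ABw jm; set X := two_apex_ratio m A B w e.
have dm := bin_ratio_diff2 m jm; have dN := bin_ratio_diff2 m.+1 jm.
have dA := bin_ratio_diff2 A jm; have dB := bin_ratio_diff2 B jm.
have dw := bin_ratio_diff2 w jm; have dw1 := bin_ratio_diff2 w.+1 jm.
rewrite -subr_ge0.
set D : rat := (m.+1%:R - j%:R) * (m.+1%:R - j%:R - 1) in dm dN dA dB dw dw1.
have D0 : 0 < D.
  rewrite mulr_gt0 ?subr_gt0 ?ltr_nat 1?ltnW //.
  by rewrite -(ltrD2r j%:R) subrK addrC natr1 ltr_nat.
pose a := (m - A)%N; pose b := (m - B)%N; pose g := (m - w)%N.
have ea : m.+1%:R - A%:R = a%:R + 1 :> rat by rewrite -natr1 natrB //; ring.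
have eb : m.+1%:R - B%:R = b%:R + 1 :> rat by rewrite -natr1 natrB //; ring.
have wm : (w <= m)%N by apply: leq_trans Am.
have eg : m.+1%:R - w%:R = g%:R + 1 :> rat by rewrite -natr1 natrB //; ring.
have eg1 : m.+1%:R - w.+1%:R = g%:R :> rat by rewrite -!natr1 natrB //; ring.
have em : m.+1%:R - m%:R = 1 :> rat by rewrite -natr1; ring.
rewrite ea in dA; rewrite eb in dB; rewrite eg in dw; rewrite eg1 in dw1.
(* The ratios of [m] and [m + 1] have [r = 1] and [r = 0], so their second differences vanish. *)
rewrite em subrr mulr0 !mul0r in dm; rewrite subrr !mul0r in dN.
rewrite addrK in dA; rewrite addrK in dB; rewrite addrK in dw.
pose pA := bin_ratio m.+1 A j; pose pB := bin_ratio m.+1 B j.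
pose pw := bin_ratio m.+1 w j; pose pw1 := bin_ratio m.+1 w.+1 j.
have -> : X j.+1 *+ 2 - (X j + X j.+2)
  = ((a%:R + 1) * a%:R * pA + (b%:R + 1) * b%:R * pB
     + e%:R * (g%:R * (g%:R - 1) * pw1 - (g%:R + 1) * g%:R * pw)) / D.
  rewrite /X /two_apex_ratio /pA /pB /pw /pw1.
  move: dm dN dA dB dw dw1; move: D^-1 => iD.
  by case: (e) => /= *; rewrite ?mul0r ?mul1r; lra.
apply: divr_ge0 (ltW D0).
have gab : g%:R <= a%:R + b%:R :> rat by rewrite -natrD ler_nat /g /a /b; lia.
have hA : pw <= pA by apply: bin_ratio_le.
have hB : pw <= pB by apply: bin_ratio_le.
have hw : pw <= pw1 by apply: bin_ratio_le.
have [pA0 pB0 pw0] : [/\ 0 <= pA, 0 <= pB & 0 <= pw] by split; apply: bin_ratio_ge0.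
have [a0 b0] : 0 <= a%:R :> rat /\ 0 <= b%:R :> rat by split; apply: ler0n.
case: {X} e => /=; last first.
  by rewrite mul0r addr0; apply: addr_ge0; do 2 (apply: mulr_ge0 => //); apply: addr_ge0.
(* Write [a (a + 1) = a (a - 1) + 2 a], likewise for [b], and [g (g + 1) = g (g - 1) + 2 g]: the
   goal is [h1 + h2 + h3 + 2 (h4 + h5 + h6)]. *)
have h1 := mulr_ge0 (natr_mul_pred_ge0 a) pA0.
have h2 := mulr_ge0 (natr_mul_pred_ge0 b) pB0.
have h3 : 0 <= g%:R * (g%:R - 1) * (pw1 - pw).
  by rewrite mulr_ge0 ?subr_ge0 // natr_mul_pred_ge0.
have h4 : 0 <= a%:R * (pA - pw) by rewrite mulr_ge0 ?subr_ge0.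
have h5 : 0 <= b%:R * (pB - pw) by rewrite mulr_ge0 ?subr_ge0.
have h6 : 0 <= (a%:R + b%:R - g%:R) * pw by rewrite mulr_ge0 ?subr_ge0.
lra.
Qed.

(** * Independent sets with a prescribed trace outside [M] *)

Section IndependentFibres.
Variables (G : sgraph) (M : {set G}).
Hypothesis indM : ~~ dependent M.

Definition nonneighbours (P : {set G}) : {set G} :=
  [set x in M | [forall p in P, ~~ adj p x]].

(** Such sets [S] form the interval from [P] to [P :|: nonneighbours P], since [P] and [M] are both
    independent. *)
Lemma card_independent_fibre (P : {set G}) (k : nat) :
    P \subset ~: M -> ~~ dependent P ->
  #|[set S : {set G} | [&& ~~ dependent S, #|S| == (k + #|P|)%N & S :&: ~: M == P]]|
  = 'C(#|nonneighbours P|, k).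
Proof.
move=> PM indP.
have QM : nonneighbours P \subset M by apply/subsetP => x; rewrite inE => /andP[].
have dPQ : [disjoint P & nonneighbours P].
  by rewrite disjoints_subset (subset_trans PM) // setCS.
rewrite -(card_interval k dPQ); apply: eq_card => S; rewrite !inE.
case: (#|S| == _); rewrite ?andbF //= ?andbT.
apply/andP/andP => [[indS /eqP SP]|[PS SPQ]].
  have PS : P \subset S by rewrite -SP subsetIl.
  split=> //; apply/subsetP => x xS; rewrite in_setU.
  case: (boolP (x \in M)) => xM; last by rewrite -SP !inE xS xM.
  rewrite inE xM; apply/orP; right; apply/forall_inP => p pP.
  apply: contra indS => px; apply/dependent_exP.
  by exists p, x; rewrite (subsetP PS).
have adjPQ p x : p \in P -> x \in nonneighbours P -> adj p x = false.
  by move=> pP; rewrite inE => /andP[_ /forall_inP/(_ _ pP)/negPf].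
split; last first.
  apply/eqP/setP => x; apply/setIP/idP => [[xS]|xP].
    have := subsetP SPQ x xS; rewrite in_setU => /orP[//|/(subsetP QM) xM].
    by rewrite inE xM.
  by rewrite (subsetP PS) // (subsetP PM).
apply/negP => /dependent_exP[x [y [xS yS xy]]].
have := subsetP SPQ x xS; have := subsetP SPQ y yS; rewrite !in_setU.
case/orP=> yP /orP[] xP.
- by case/negP: indP; apply/dependent_exP; exists x, y.
- by rewrite adj_sym adjPQ in xy.
- by rewrite adjPQ in xy.
- by case/negP: indM; apply/dependent_exP; exists x, y; rewrite !(subsetP QM).
Qed.

Lemma setI2_eq (a b : G) (S P : {set G}) : P \subset [set a; b] ->
  (S :&: [set a; b] == P) = ((a \in S) == (a \in P)) && ((b \in S) == (b \in P)).
Proof.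
move=> Pab; apply/eqP/andP => [<-|[/eqP Ha /eqP Hb]].
  by rewrite !inE !eqxx orbT !andbT.
apply/setP => x; rewrite !inE; case: eqP => [->|xa]; first by rewrite andbT Ha.
case: eqP => [->|xb]; first by rewrite andbT Hb.
rewrite andbF; apply/esym/negP => /(subsetP Pab).
by rewrite !inE => /orP[] /eqP.
Qed.

Lemma dependent1 (x : G) : dependent [set x] = false.
Proof.
apply/dependent_exP => -[y [z [/set1P-> /set1P->]]]; by rewrite adj_irr.
Qed.

Lemma dependent2 (x y : G) : dependent [set x; y] = adj x y.
Proof.
apply/dependent_exP/idP => [[u [v []]]|xy]; last by exists x, y; rewrite !inE !eqxx orbT.
by move=> /set2P[]-> /set2P[]->; rewrite ?adj_irr // adj_sym.
Qed.

Variables a b : G.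
Hypotheses (ab : a != b) (MC : ~: M = [set a; b]).

(** The four terms are the traces [set0], [{a}], [{b}] and [{a, b}]; the last is possible only when
    [a] and [b] are not adjacent. *)
Lemma independent_count2 (k : nat) :
  #|[set S : {set G} | ~~ dependent S & #|S| == k.+2]|
  = ('C(#|M|, k.+2) + 'C(#|nonneighbours [set a]|, k.+1)
     + 'C(#|nonneighbours [set b]|, k.+1)
     + ~~ adj a b * 'C(#|nonneighbours [set a; b]|, k))%N.
Proof.
set E := [set S | _ & _].
have ba : b != a by rewrite eq_sym.
have sub1 : [set a] \subset ~: M by rewrite MC sub1set !inE eqxx.
have sub2 : [set b] \subset ~: M by rewrite MC sub1set !inE eqxx orbT.
have nn0 : nonneighbours set0 = M.
  apply/setP => x; rewrite inE; case: (x \in M) => //=.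
  by apply/forall_inP => p; rewrite inE.
rewrite -(cardsID [set S : {set G} | a \in S] E).
rewrite -(cardsID [set S : {set G} | b \in S] (E :&: _)).
rewrite -(cardsID [set S : {set G} | b \in S] (E :\: _)).
have fib (P : {set G}) (j : nat) (F : {set {set G}}) :
    P \subset ~: M -> ~~ dependent P -> (j + #|P|)%N = k.+2 ->
    (forall S, (S \in F) = [&& ~~ dependent S, #|S| == k.+2,
       (a \in S) == (a \in P) & (b \in S) == (b \in P)]) ->
    #|F| = 'C(#|nonneighbours P|, j).
  move=> PM indP jk HF; rewrite -card_independent_fibre //; apply: eq_card => S.
  by rewrite HF !inE jk MC setI2_eq // -MC.
rewrite (fib set0 k.+2 (E :\: _ :\: _)); first last.
- by move=> S; rewrite !inE !eqbF_neg; case: (a \in S); case: (b \in S); rewrite ?andbT ?andbF.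
- by rewrite cards0 addn0.
- by apply/dependent_exP => -[x [y []]]; rewrite inE.
- by rewrite sub0set.
rewrite (fib [set a] k.+1 (E :&: _ :\: _)); first last.
- move=> S; rewrite !inE eqxx (negPf ba) eqbF_neg eqb_id.
  by case: (a \in S); case: (b \in S); rewrite ?andbT ?andbF.
- by rewrite cards1 addn1.
- by rewrite dependent1.
- by [].
rewrite (fib [set b] k.+1 ((E :\: _) :&: _)); first last.
- move=> S; rewrite !inE eqxx (negPf ab) eqbF_neg eqb_id.
  by case: (a \in S); case: (b \in S); rewrite ?andbT ?andbF.
- by rewrite cards1 addn1.
- by rewrite dependent1.
- by [].
suff -> : #|E :&: [set S : {set G} | a \in S] :&: [set S : {set G} | b \in S]|
    = (~~ adj a b * 'C(#|nonneighbours [set a; b]|, k))%N by rewrite nn0; lia.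
case: (boolP (adj a b)) => adjab.
  rewrite mul0n; apply/eqP; rewrite cards_eq0 -subset0; apply/subsetP => S.
  rewrite !inE => /andP[/andP[/andP[indS _] aS] bS].
  by case/negP: indS; apply/dependent_exP; exists a, b.
rewrite mul1n; apply: fib.
- by rewrite MC.
- by rewrite dependent2.
- by rewrite cards2 ab addn2.
move=> S; rewrite !inE !eqxx orbT !eqb_id.
by case: (a \in S); case: (b \in S); rewrite ?andbT ?andbF.
Qed.

(** Subtract the independent sets from all sets. Pascal's rule turns [C(m+2, k+2) - C(m, k+2)] into
    [C(m, k+1) + C(m+1, k+1)], and [C(w, k)] into [C(w+1, k+1) - C(w, k+1)]. *)
Lemma dep_num_ratio (k : nat) : (k <= #|M|)%N ->
  (dep_num G k.+2)%:R / 'C(#|M|.+1, k.+1)%:R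
  = two_apex_ratio #|M| #|nonneighbours [set a]| #|nonneighbours [set b]|
      #|nonneighbours [set a; b]| (~~ adj a b) k.+1.
Proof.
move=> kM.
have cG : #|G| = #|M|.+2 by rewrite -(cardsC M) MC cards2 ab addn2.
have tot : (dep_num G k.+2
    + #|[set S : {set G} | ~~ dependent S & #|S| == k.+2]|)%N = 'C(#|M|.+2, k.+2).
  have := cardsID [set S : {set G} | dependent S] [set S : {set G} | #|S| == k.+2].
  rewrite card_draws cG => <-.
  by congr (_ + _)%N; apply: eq_card => S; rewrite !inE // andbC.
set A := #|nonneighbours [set a]|; set B := #|nonneighbours [set b]|.
set w := #|nonneighbours [set a; b]|; set e := ~~ adj a b; set m := #|M|.
have {tot} : (dep_num G k.+2 + 'C(A, k.+1) + 'C(B, k.+1) + e * 'C(w, k)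
    = 'C(m, k.+1) + 'C(m.+1, k.+1))%N.
  move: tot; rewrite independent_count2 (binS m.+1) (binS m k.+1).
  by rewrite -/A -/B -/w -/m -/e; lia.
rewrite /two_apex_ratio /bin_ratio (binS w) natrD.
have : (0 < 'C(m.+1, k.+1))%N by rewrite bin_gt0.
move: 'C(m.+1, k.+1) => c; rewrite lt0n -(pnatr_eq0 rat) => c0.
move/(congr1 (fun x => x%:R : rat)); rewrite !natrD natrM => E.
have {E} -> : (dep_num G k.+2)%:R = 'C(m, k.+1)%:R + c%:R
    - 'C(A, k.+1)%:R - 'C(B, k.+1)%:R - e%:R * 'C(w, k)%:R :> rat by rewrite -E; ring.
by field.
Qed.

End IndependentFibres.

(** * Graphs with an independent set missing two vertices *)

Lemma ulc_of_cover2 (G : sgraph) (M : {set G}) (a b : G) :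
    ~~ dependent M -> a != b -> ~: M = [set a; b] ->
  ultra_log_concave #|G| (dep_poly G).
Proof.
move=> indM ab MC; apply: ulc_of_normalized => -[//|k] /= kn.
have kn1 := ltnW kn; have kn0 := ltnW kn1.
rewrite !dep_polyE //.
case: (ltnP k 2) => k2.
  by rewrite (dep_num_small _ k2) !mul0r exprn_ge0 // divr_ge0 // ler0n.
have cG : #|G| = #|M|.+2 by rewrite -(cardsC M) MC cards2 ab addn2.
case: k k2 kn kn1 kn0 => [//|[//|k]] _; rewrite cG => kn _ _.
(* This is [x_(j+2)], as [n = #|M| + 2]; [E] rests on [n C(n-1, i-1) = i C(n, i)] with
   [i = j + 2]. *)
pose y j : rat := (dep_num G j.+2)%:R / 'C(#|M|.+1, j.+1)%:R.
have E j : (j <= #|M|)%N ->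
    (dep_num G j.+2)%:R / 'C(#|M|.+2, j.+2)%:R = j.+2%:R / #|M|.+2%:R * y j.
  move=> jM; have D := mul_bin_diag #|M|.+2 j.+1.
  have b1 : 'C(#|M|.+1, j.+1)%:R != 0 :> rat by rewrite pnatr_eq0 -lt0n bin_gt0.
  have b2 : 'C(#|M|.+2, j.+2)%:R != 0 :> rat by rewrite pnatr_eq0 -lt0n bin_gt0.
  have m0 : #|M|.+2%:R != 0 :> rat by rewrite pnatr_eq0.
  apply: (mulIf b2); rewrite divfK // /y; move/(congr1 (fun x => x%:R : rat)): D.
  rewrite /= !natrM => D; apply: (mulIf m0); apply: (mulIf b1).
  transitivity ((dep_num G j.+2)%:R * (#|M|.+2%:R * 'C(#|M|.+1, j.+1)%:R) : rat).
    by rewrite mulrA.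
  rewrite D; move: b1 m0 {D b2}; move: 'C(_.+1, _)%:R 'C(_, _)%:R => c1 c2.
  move: #|M|.+2%:R j.+2%:R => p q c1N pN.
  by field; rewrite c1N pN.
rewrite !E; try lia.
have y0 j : 0 <= y j by rewrite divr_ge0 ?ler0n.
have conc : y k * y k.+2 <= y k.+1 ^+ 2.
  apply: mul_le_sqr_of_concave => //; rewrite /y !(dep_num_ratio indM ab MC); try lia.
  have sub P : nonneighbours M P \subset M.
    by apply/subsetP => x; rewrite inE => /andP[].
  have nnI : nonneighbours M [set a; b]
      = nonneighbours M [set a] :&: nonneighbours M [set b].
    apply/setP => x; rewrite !inE; case: (x \in M) => //=.
    apply/forall_inP/andP => [H|[/forall_inP Ha /forall_inP Hb] p].
      by split; apply/forall_inP => p /set1P->; apply: H; rewrite !inE eqxx ?orbT.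
    by case/set2P=> ->; [apply: Ha | apply: Hb]; rewrite inE.
  apply: two_apex_concave; rewrite ?subset_leq_card ?nnI ?subsetIl ?subsetIr //.
  (* [A + B] is the size of the union plus that of the intersection; the union lies in [M] and the
     intersection has size [w]. *)
  by rewrite -cardsUI leq_add2r subset_leq_card // subUset !sub.
have kk : k.+2%:R * k.+4%:R <= k.+3%:R ^+ 2 :> rat.
  by rewrite -!natrM -natrX ler_nat; lia.
rewrite exprMn expr_div_n mulrACA.
have -> : k.+2%:R / #|M|.+2%:R * (k.+4%:R / #|M|.+2%:R)
          = (k.+2%:R * k.+4%:R) / #|M|.+2%:R ^+ 2 :> rat.
  by rewrite mulrACA -invfM -expr2.
apply: ler_pM => //; first by rewrite divr_ge0 ?mulr_ge0 ?exprn_ge0 ?ler0n.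
  by rewrite mulr_ge0.
by rewrite ler_wpM2r // invr_ge0 exprn_ge0 ?ler0n.
Qed.

Theorem theorem1p2 (G : sgraph) (n : nat) (hn : #|G| = n)
  (hE : has_edge G)
  (hG : free_of K2_2K1 G \/
        exists S : {set G}, independent S /\ #|S| = (n - 2)%N) :
  ultra_log_concave n (dep_poly G).
Proof.
rewrite -hn; case: hG => [|[M [indM cM]]]; first exact: ulc_of_free.
(* The edge gives [n >= 2], so the truncated [n - 2] is a true difference and the complement of [M]
   has exactly two vertices. *)
have n2 : (1 < #|G|)%N.
  case: hE => x [y xy]; rewrite -cardsT; apply/card_gt1P; exists x, y.
  by split=> //; apply: contraTneq xy => ->; rewrite adj_irr.
have /cards2P[a [b [ab MC]]] : #|~: M| == 2%N.
  by rewrite -(eqn_add2l #|M|) cardsC cM -hn subnK.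
apply: (@ulc_of_cover2 G M a b) => //.
by apply/negP => /dependentP.
Qed.
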